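(* Let $n$ be a positive integer, $p\ge 3$ a prime, and $r\ge 1$ an integer with $p^{r}\mid n$. Then \[\sum_{\substack{i+j+k=n\\ i,j,k\in \mathcal{P}_{p}}}\frac{(-1)^{i}}{ijk}\equiv \frac{n}{2p}B_{p-3}\pmod{p^{r}},\] where the sum runs over all ordered triples $(i,j,k)$ of positive integers, each prime to $p$, with $i+j+k=n$.
   Context: $\mathcal{P}_{p}$ denotes the set of positive integers that are prime to $p$. $B_n$ denotes the $n$-th Bernoulli number, defined by $\frac{x}{e^x-1}=\sum_{n\ge 0}\frac{B_n}{n!}x^n$. Congruences between rational numbers whose denominators are prime to $p$ are understood in the ring of $p$-integral rationals $\mathbb{Z}_{(p)}$, i.e. $a\equiv b \pmod{p^r}$ means $(a-b)/p^r$ is a rational number with denominator prime to $p$. *)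

(* Defs.v *)
From mathcomp Require Import all_boot all_order all_algebra.

Set Implicit Arguments.
Unset Strict Implicit.
Unset Printing Implicit Defensive.

Import Order.TTheory GRing.Theory Num.Theory.
Local Open Scope ring_scope.

(* Formal power series over the rationals, as coefficient sequences. *)
Definition fps_mul (a b : nat -> rat) (n : nat) : rat :=
  \sum_(k < n.+1) a k * b (n - k)%N.

Definition fps_X (n : nat) : rat := (n == 1%N)%:R.

Definition fps_expm1 (n : nat) : rat :=
  if n == 0%N then 0 else (n`!%:R)^-1.

(* The defining identity x / (e^x - 1) = \sum_n (B n / n!) x^n, with the
   denominator cleared. *)
Definition is_bernoulli (B : nat -> rat) : Prop :=
  forall n, fps_mul (fun m => B m / m`!%:R) fps_expm1 n = fps_X n.

(* The coefficients c_0, ..., c_(n-1) of x / (e^x - 1), i.e. of the inverse of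
   (e^x - 1) / x = \sum_m x^m / (m + 1)!. *)
Fixpoint bernoulli_coefs (n : nat) : seq rat :=
  if n is m.+1 then
    let c := bernoulli_coefs m in
    rcons c ((m == 0%N)%:R - \sum_(k < m) c`_k / ((m - k).+1)`!%:R)
  else [::].

Definition bernoulli (n : nat) : rat := n`!%:R * (bernoulli_coefs n.+1)`_n.

Lemma size_bernoulli_coefs n : size (bernoulli_coefs n) = n.
Proof. by elim: n => //= n IHn; rewrite size_rcons IHn. Qed.

Lemma nth_bernoulli_coefs n k : (k < n)%N ->
  (bernoulli_coefs n)`_k = (bernoulli_coefs k.+1)`_k.
Proof.
elim: n => // n IHn; rewrite ltnS leq_eqVlt => /orP[/eqP -> //|lt_kn].
by rewrite -IHn //= nth_rcons size_bernoulli_coefs lt_kn.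
Qed.

Lemma fact_neq0 n : n`!%:R != 0 :> rat.
Proof. by rewrite pnatr_eq0 -lt0n fact_gt0. Qed.

Lemma bernoulli_divf n :
  bernoulli n / n`!%:R =
  (n == 0%N)%:R - \sum_(k < n) bernoulli k / k`!%:R / ((n - k).+1)`!%:R.
Proof.
rewrite {1}/bernoulli mulrAC mulfV ?fact_neq0 // mul1r /=.
rewrite nth_rcons size_bernoulli_coefs ltnn eqxx; congr (_ - _).
apply: eq_bigr => k _; rewrite nth_bernoulli_coefs ?ltn_ord //.
by rewrite /bernoulli [_ * _ / k`!%:R]mulrAC mulfV ?fact_neq0 // mul1r.
Qed.

Lemma fps_mul_expm1S (c : nat -> rat) n :
  fps_mul c fps_expm1 n.+1 = \sum_(k < n) c k / ((n - k).+1)`!%:R + c n.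
Proof.
rewrite /fps_mul big_ord_recr /= subnn {2}/fps_expm1 eqxx mulr0 addr0.
rewrite big_ord_recr /= subSnn /fps_expm1 /= invr1 mulr1; congr (_ + _).
by apply: eq_bigr => k _; rewrite subSn // ltnW.
Qed.

Lemma bernoulliP : is_bernoulli bernoulli.
Proof.
case=> [|n]; first by rewrite /fps_mul big_ord1 /fps_expm1 mulr0.
by rewrite fps_mul_expm1S bernoulli_divf addrC subrK /fps_X eqSS.
Qed.

Lemma bernoulli_unique B : is_bernoulli B -> B =1 bernoulli.
Proof.
move=> HB n; elim/ltn_ind: n => n IHn.
suff: B n / n`!%:R = bernoulli n / n`!%:R.
  by move/(mulIf _); apply; rewrite invr_eq0 fact_neq0.
have := HB n.+1; rewrite -(bernoulliP n.+1) !fps_mul_expm1S.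
rewrite (eq_bigr (fun k : 'I_n =>
  bernoulli k / k`!%:R / ((n - k).+1)`!%:R)); first exact: addrI.
by move=> k _; rewrite IHn.
Qed.

Definition prime_to (p m : nat) : bool := (0 < m)%N && coprime m p.

Definition p_integral (p : nat) (x : rat) : bool := coprime `|denq x|%N p.

Definition eq_modp (p r : nat) (a b : rat) : bool :=
  p_integral p ((a - b) / p%:R ^+ r).

(* Main.v *)
Require Import Defs.
From mathcomp Require Import all_boot all_order all_algebra.
From mathcomp Require Import cyclic zify ring lra.

(** Put q = p^r and n = m q, and reduce everything modulo q.  Then
    1 / (i j k) = - 1 / (i j (i + j)) is q-periodic in i and j, while (-1)^i is
    q-antiperiodic.  Splitting the triangle i + j < n into blocks of side q and
    reflecting (i, j) to (q - i, q - j) gives 2 S = m H, where H is the same sum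
    over the full square i, j < q.  In H, partial fractions turn the sum over j
    into 2 / i times the sum of the inverses of the residues modulo q that are
    congruent to i modulo p; inversion permutes such classes, so that sum is
    p^(r-1) / i.  Hence S = - m p^(r-1) sum_(0 < a < p) (-1)^a / a^3, where the
    last sum matters only modulo p and is sum_a (-1)^a a^(p-4) by Fermat (for
    p > 3).  Modulo p, the alternating power sums satisfy the recurrence of the
    coefficients of 2 / (e^x + 1), and x / (e^x + 1) = B(x) - B(2 x) for
    B(x) = x / (e^x - 1), which brings in B_(p-3). *)

Set Implicit Arguments.
Unset Strict Implicit.
Unset Printing Implicit Defensive.

Import Order.TTheory GRing.Theory Num.Theory.
Local Open Scope ring_scope.

(** * Signed sums over triangles and squares, for an odd period q *)

Lemma sum_nat_shift (V : nmodType) (f : nat -> V) (q N : nat) :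
  \sum_(q <= j < q + N) f j = \sum_(0 <= j < N) f (j + q)%N.
Proof. by rewrite -{1}(add0n q) big_addn addKn. Qed.

Section TriangleSums.

Variables (R : comNzRingType) (phi : nat -> nat -> R) (q : nat).

Definition triangle_sum (m : nat) : R :=
  \sum_(0 <= i < m * q) (-1) ^+ i * \sum_(0 <= j < m * q - i) phi i j.

Definition square_sum : R :=
  \sum_(0 <= i < q) (-1) ^+ i * \sum_(0 <= j < q) phi i j.

Lemma sum_nat_periodic (f : nat -> R) (m s : nat) :
  (forall j, f (j + q)%N = f j) ->
  \sum_(0 <= j < m * q + s) f j =
  (\sum_(0 <= j < q) f j) *+ m + \sum_(0 <= j < s) f j.
Proof.
move=> fq; elim: m => [|m IHm]; first by rewrite mulr0n add0r.
rewrite mulSn -addnA (@big_cat_nat _ _ _ q) ?leq_addr //=.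
rewrite (sum_nat_shift _ q); under [X in _ + X]eq_bigr do rewrite fq.
by rewrite IHm addrA -mulrS.
Qed.

Hypothesis odd_q : odd q.
Hypothesis phi_perl : forall i j, phi (i + q) j = phi i j.
Hypothesis phi_perr : forall i j, phi i (j + q) = phi i j.

(** Split off the first q rows. As q is odd, the remaining rows form minus [triangle_sum m]; a
    removed row has length m q + (q - i), that is, m full periods followed by a row of the triangle
    of side q. *)
Lemma triangle_sumS (m : nat) :
  triangle_sum m.+1 + triangle_sum m = square_sum *+ m + triangle_sum 1.
Proof.
rewrite {1}/triangle_sum mulSn (@big_cat_nat _ _ _ q) ?leq_addr //=.
rewrite (sum_nat_shift _ q) -addrA.
rewrite [X in _ + (X + _)](_ : _ = - triangle_sum m) ?addNr ?addr0; last first.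
  rewrite -sumrN; apply: eq_bigr => i _.
  rewrite exprD -[(-1) ^+ q]signr_odd odd_q expr1 mulrN1 mulNr; congr (- (_ * _)).
  rewrite (_ : q + m * q - (i + q) = m * q - i)%N; last by lia.
  by apply: eq_bigr => j _; exact: phi_perl.
rewrite /triangle_sum /square_sum mul1n -sumrMnl -big_split /= !big_nat.
apply: eq_bigr => i /andP[_ lt_iq].
rewrite (_ : q + m * q - i = m * q + (q - i))%N; last by lia.
by rewrite sum_nat_periodic // mulrDr mulrnAr.
Qed.

Hypothesis phi0l : forall j, phi 0 j = 0.
Hypothesis phi0r : forall i, phi i 0 = 0.
Hypothesis phi_diag : forall i, (i <= q)%N -> phi i (q - i) = 0.
Hypothesis phi_opp : forall i j, (i <= q)%N -> (j <= q)%N ->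
  phi (q - i) (q - j) = - phi i j.

(* The reflection (i, j) -> (q - i, q - j) exchanges the two triangles into
   which the antidiagonal i + j = q cuts the square. *)
Lemma triangle_sum1 : triangle_sum 1 *+ 2 = square_sum.
Proof.
have q_gt0 : (0 < q)%N by case: (q) odd_q.
pose f i j := if (i + j < q)%N then (-1) ^+ i * phi i j else 0.
pose g i j := if (q < i + j)%N then (-1) ^+ i * phi i j else 0.
have Tf : triangle_sum 1 = \sum_(1 <= i < q) \sum_(1 <= j < q) f i j.
  rewrite /triangle_sum mul1n (big_ltn q_gt0).
  rewrite [X in _ * X]big1 => [|j _]; last exact: phi0l.
  rewrite mulr0 add0r !big_nat; apply: eq_bigr => i /andP[i_gt0 lt_iq].
  rewrite mulr_sumr big_ltn ?subn_gt0 // phi0r mulr0 add0r.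
  rewrite [RHS](@big_cat_nat _ _ _ (q - i)) ?subn_gt0 ?leq_subr //=.
  rewrite [X in _ + X]big_nat_cond [X in _ + X]big1 ?addr0 => [|j].
    rewrite !big_nat; apply: eq_bigr => j Hj.
    by rewrite /f ifT //; lia.
  by rewrite /f => Hj; rewrite ifF //; lia.
have Tg : triangle_sum 1 = \sum_(1 <= i < q) \sum_(1 <= j < q) g i j.
  rewrite Tf big_nat_rev /= !big_nat; apply: eq_bigr => i Hi.
  rewrite big_nat_rev /= !big_nat; apply: eq_bigr => j Hj.
  rewrite /f /g !add1n !subSS.
  rewrite (_ : (q - i + (q - j) < q)%N = (q < i + j)%N); last by lia.
  (* The sign from [phi_opp] cancels the one in (-1)^(q - i) = - (-1)^i, q being odd. *)
  case: ifP => // _; rewrite phi_opp; [|lia|lia].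
  rewrite mulrN -mulNr; congr (_ * _).
  rewrite -signr_odd oddB ?odd_q; last by lia.
  by rewrite -[in RHS]signr_odd; case: (odd i); rewrite /= ?expr0 ?expr1 ?opprK.
rewrite mulr2n {1}Tf Tg -big_split /square_sum (big_ltn q_gt0).
rewrite [X in _ = _ * X + _]big1 => [|j _]; last exact: phi0l.
rewrite mulr0 add0r !big_nat; apply: eq_bigr => i /andP[i_gt0 lt_iq].
rewrite -big_split (big_ltn q_gt0) phi0r add0r mulr_sumr /= !big_nat.
apply: eq_bigr => j Hj; rewrite /f /g; case: ltngtP => [_|_|E].
- by rewrite addr0.
- by rewrite add0r.
by rewrite (_ : j = q - i)%N ?phi_diag ?mulr0 ?addr0 //; lia.
Qed.

Lemma triangle_sum2 (m : nat) : triangle_sum m *+ 2 = square_sum *+ m.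
Proof.
elim: m => [|m IHm]; first by rewrite /triangle_sum mul0n big_nil mul0rn.
apply: (addIr (square_sum *+ m)).
rewrite -{1}IHm -mulrnDl triangle_sumS mulrnDl triangle_sum1.
by rewrite -mulrnA muln2 -addnn mulrnDr addrC addrA -mulrS.
Qed.

End TriangleSums.

(** * Sums of inverses modulo a prime power *)

(** The ring inverse [x^-1] of a non-unit is x itself; the value 0 instead makes indices divisible
    by p drop out of the sums. *)
Definition unit_inv (R : unitRingType) (x : R) : R :=
  if x \is a GRing.unit then x^-1 else 0.

Lemma unit_invN (R : unitRingType) (x : R) : unit_inv (- x) = - unit_inv x.
Proof. by rewrite /unit_inv unitrN; case: ifP; rewrite ?oppr0 ?invrN. Qed.

Lemma unit_inv0 (R : unitRingType) : unit_inv (0 : R) = 0.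
Proof. by rewrite /unit_inv unitr0. Qed.

Lemma natZp_eq0 (q k : nat) : (1 < q)%N -> (k%:R == 0 :> 'Z_q) = (q %| k)%N.
Proof. by move=> q_gt1; rewrite -val_eqE /= val_Zp_nat. Qed.

Lemma sum_Zp (q : nat) (V : nmodType) (f : 'Z_q -> V) : (1 < q)%N ->
  \sum_(0 <= j < q) f j%:R = \sum_(x : 'Z_q) f x.
Proof.
move=> q_gt1; rewrite -{1}(Zp_cast q_gt1) big_mkord.
by apply: eq_bigr => x _; rewrite natr_Zp.
Qed.

Section PrimePowerModulus.

Variables (p s : nat).
Hypothesis p_prime : prime p.
Hypothesis p_odd : odd p.

Local Notation q := (p ^ s.+1)%N.
Local Notation Zq := 'Z_q.

Lemma ppow_gt1 : (1 < q)%N.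
Proof. by rewrite -(exp1n s.+1) ltn_exp2r // prime_gt1. Qed.
Local Hint Resolve ppow_gt1 : core.

Lemma unit_natZq (k : nat) : (k%:R \is a @GRing.unit Zq) = ~~ (p %| k)%N.
Proof. by rewrite unitZpE // coprime_pexpl // prime_coprime. Qed.

Lemma unit2Zq : (2%:R : Zq) \is a GRing.unit.
Proof.
rewrite unit_natZq; apply: contraL p_odd => /dvdn_leq -/(_ isT) le_p2.
by have := prime_gt1 p_prime; case: p le_p2 => [|[|[|]]].
Qed.

(* The non-units form the ideal (p), which is the annihilator of p^s. *)
Lemma nonunitZqE (x : Zq) :
  (x \isn't a GRing.unit) = ((p ^ s)%:R * x == 0).
Proof.
have dvdE k : (p %| k)%N = (q %| p ^ s * k)%N.
  by rewrite expnSr dvdn_pmul2l // expn_gt0 prime_gt0.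
by rewrite -(natr_Zp x) unit_natZq negbK -natrM natZp_eq0 // dvdE.
Qed.

Lemma nonunitZqD (x e : Zq) : e \isn't a GRing.unit ->
  (x + e \is a GRing.unit) = (x \is a GRing.unit).
Proof.
move=> He; apply: negb_inj; rewrite !nonunitZqE mulrDr.
by move: He; rewrite nonunitZqE => /eqP ->; rewrite addr0.
Qed.

Lemma nonunitZqM (x e : Zq) : e \isn't a GRing.unit -> x * e \isn't a GRing.unit.
Proof. by rewrite !nonunitZqE mulrCA => /eqP ->; rewrite mulr0. Qed.

(** Negation permutes the non-units, so the sum is its own opposite, and 2 is a unit. *)
Lemma sum_nonunitZq : \sum_(e : Zq | e \isn't a GRing.unit) e = 0.
Proof.
apply: (mulIr unit2Zq); rewrite mul0r mulr_natr mulr2n.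
apply/eqP; rewrite addr_eq0 -sumrN (reindex_inj (@oppr_inj Zq)) /=.
by apply/eqP/eq_bigl => e; rewrite unitrN.
Qed.

Lemma card_nonunitZq :
  \sum_(e : Zq | e \isn't a GRing.unit) 1 = (p ^ s)%:R :> Zq.
Proof.
pose f (j : nat) : Zq := if (p %| j)%N then 1 else 0.
transitivity (\sum_(0 <= j < q) f j).
  rewrite big_mkcond /=.
  rewrite -(@sum_Zp q _ (fun x => if x \isn't a GRing.unit then 1 else 0)) //.
  by apply: eq_bigr => j _; rewrite unit_natZq negbK.
have fp j : f (j + p)%N = f j by rewrite /f dvdn_addl.
have := sum_nat_periodic (p ^ s) 0 fp; rewrite addn0 -expnSr => ->.
rewrite big_nil addr0 big_ltn ?prime_gt0 // big_nat big1 => [|j].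
  by rewrite /f dvdn0 addr0.
by case/andP=> j_gt0 lt_jp; rewrite /f gtnNdvd.
Qed.

(* Inversion maps the residue class of x modulo p onto that of 1 / x, so the
   sum of the inverses is a sum over an arithmetic progression. *)
Lemma sum_inv_class (x : Zq) : x \is a GRing.unit ->
  \sum_(e | e \isn't a GRing.unit) unit_inv (x + e) = (p ^ s)%:R * x^-1.
Proof.
move=> xU.
have invP (y e : Zq) : y \is a GRing.unit -> e \isn't a GRing.unit ->
    (y + e)^-1 - y^-1 \isn't a GRing.unit.
  move=> yU eN; have yeU : y + e \is a GRing.unit by rewrite nonunitZqD.
  rewrite (_ : _ - _ = - ((y + e)^-1 * y^-1) * e) ?nonunitZqM //.
  transitivity ((y + e)^-1 * y * y^-1 - (y + e)^-1 * (y + e) * y^-1).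
    by rewrite mulrK // mulVr // mul1r.
  by ring.
(* Fixing the units extends the map on non-units to a bijection of the whole ring, as reindexing
   requires. *)
pose f (y e : Zq) := if e \is a GRing.unit then e else (y + e)^-1 - y^-1.
have fK (y : Zq) : y \is a GRing.unit -> cancel (f y) (f y^-1).
  move=> yU e; rewrite /f; case: (boolP (e \is a GRing.unit)) => [-> //|eN].
  by rewrite (negPf (invP y e yU eN)) [y^-1 + _]addrC subrK
     !invrK [y + e]addrC addrK.
have fB : bijective (f x).
  exists (f x^-1); first exact: fK.
  by rewrite -{2}[x]invrK; apply: fK; rewrite unitrV.
have fN e : (f x e \isn't a GRing.unit) = (e \isn't a GRing.unit).
  rewrite /f; case: (boolP (e \is a GRing.unit)) => [-> //|eN]; exact: invP.
transitivity (\sum_(e : Zq | e \isn't a GRing.unit) (x^-1 + e)).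
  rewrite [RHS](reindex (f x)) /=; last exact: onW_bij.
  under [RHS]eq_bigl do rewrite fN.
  apply: eq_bigr => e eN; rewrite /unit_inv nonunitZqD // xU /f (negPf eN).
  by rewrite [RHS]addrC subrK.
rewrite big_split /= sum_nonunitZq addr0 -card_nonunitZq mulr_suml.
by apply: eq_bigr => e _; rewrite mul1r.
Qed.

(** Partial fractions: 1 / (b (x + b)) = (1 / x) (1 / b - 1 / (x + b)). The terms with [N] remove
    the cases where only one of b and x + b is a unit. The full sums cancel by translation, and each
    correction is p^s / x up to sign by [sum_inv_class]. *)
Lemma sum_inv_shift (x : Zq) : x \is a GRing.unit ->
  \sum_b unit_inv b * unit_inv (x + b) = (p ^ s)%:R * x^-1 ^+ 2 *+ 2.
Proof.
move=> xU.
pose N (y : Zq) : Zq := (y \isn't a GRing.unit)%:R.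
have partial (b : Zq) : unit_inv b * unit_inv (x + b) =
    x^-1 * (unit_inv b - N (x + b) * unit_inv b
            - (unit_inv (x + b) - N b * unit_inv (x + b))).
  rewrite /unit_inv /N; case: (boolP (b \is a GRing.unit)) => [bU|bN];
    case: (boolP (x + b \is a GRing.unit)) => [xbU|xbN] /=;
    rewrite ?mul0r ?mulr0 ?mul1r ?subr0 ?subrr ?mulr0 //.
  apply: (mulrI xU); rewrite mulVKr //.
  apply: (mulrI bU); rewrite mulrBr mulrV // mulrCA mulVKr //.
  apply: (mulIr xbU); rewrite mulrBl mul1r -!mulrA !mulVr // !mulr1.
  by rewrite addrK.
under eq_bigr do rewrite partial.
rewrite -mulr_sumr !sumrB.
have shift : \sum_(b : Zq) unit_inv (x + b) = \sum_(b : Zq) unit_inv b.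
  by rewrite [RHS](reindex_inj (@addrI Zq x)).
have R1 : \sum_b N b * unit_inv (x + b) = (p ^ s)%:R * x^-1.
  rewrite -sum_inv_class // [RHS]big_mkcond; apply: eq_bigr => b _.
  by rewrite /N; case: (_ \is a _); rewrite /= ?mul0r ?mul1r.
have R2 : \sum_b N (x + b) * unit_inv b = - ((p ^ s)%:R * x^-1).
  rewrite -R1 -sumrN.
  (* The substitution b -> - (x + b) exchanges b and x + b up to sign. *)
  rewrite (reindex_inj (inj_comp (@oppr_inj Zq) (@addrI Zq x))) /=.
  apply: eq_bigr => b _.
  by rewrite opprD addrA subrr sub0r -opprD unit_invN mulrN /N unitrN.
rewrite shift R1 R2 opprK opprB addrC addrA subrK mulrDr mulrCA -expr2.
by rewrite mulr2n.
Qed.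

(* When q divides n, the third index n - i - j is - (i + j) modulo q. *)
Definition harmonic_phi (i j : nat) : Zq :=
  - (unit_inv i%:R * unit_inv j%:R * unit_inv (i + j)%:R).

Lemma harmonic_square : square_sum harmonic_phi q =
  - ((p ^ s)%:R * \sum_(0 <= a < q) (-1) ^+ a * unit_inv (a%:R : Zq) ^+ 3) *+ 2.
Proof.
rewrite /square_sum mulr_sumr -sumrN -sumrMnl; apply: eq_bigr => a _.
have -> : \sum_(0 <= j < q) harmonic_phi a j =
    - (unit_inv a%:R * \sum_(b : Zq) unit_inv b * unit_inv (a%:R + b)).
  rewrite mulr_sumr -sumrN.
  rewrite -(sum_Zp (fun b => - (unit_inv _ * (unit_inv b * unit_inv (_ + b))))) //.
  by apply: eq_bigr => j _; rewrite /harmonic_phi natrD mulrA.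
case: (boolP ((a%:R : Zq) \is a GRing.unit)) => [aU|aN]; last first.
  by rewrite /unit_inv (negPf aN) mul0r expr0n !(oppr0, mulr0) mul0rn.
by rewrite sum_inv_shift // /unit_inv aU; ring.
Qed.

(** The factor p^s makes the inverse cubes p-periodic, while the sign is p-antiperiodic: blocks of
    length p cancel in pairs, and one of the p^s blocks is left, p^s being odd. *)
Lemma alternating_cube_sum :
  (p ^ s)%:R * \sum_(0 <= a < q) (-1) ^+ a * unit_inv (a%:R : Zq) ^+ 3 =
  (p ^ s)%:R * \sum_(0 <= a < p) (-1) ^+ a * unit_inv (a%:R : Zq) ^+ 3.
Proof.
pose f a : Zq := (p ^ s)%:R * unit_inv a%:R ^+ 3.
have pN : (p%:R : Zq) \isn't a GRing.unit by rewrite unit_natZq dvdnn.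
have fp a : f (a + p)%N = f a.
  rewrite /f natrD /unit_inv nonunitZqD //; case: ifP => // aU.
  have apU : a%:R + p%:R \is a @GRing.unit Zq by rewrite nonunitZqD.
  have E : (p ^ s)%:R * (a%:R + p%:R) = (p ^ s)%:R * a%:R :> Zq.
    by rewrite mulrDr; move: pN; rewrite nonunitZqE => /eqP ->; rewrite addr0.
  have E1 : (p ^ s)%:R * (a%:R + p%:R)^-1 = (p ^ s)%:R * a%:R^-1 :> Zq.
    apply: (mulIr apU); apply: (mulIr aU).
    by rewrite mulrVK // [RHS]mulrAC mulrVK // E.
  have cube (c u v : Zq) : c * u = c * v -> c * u ^+ 3 = c * v ^+ 3.
    move=> cuv; rewrite !exprSr expr0 !mul1r !mulrA cuv.
    by rewrite (mulrAC c v u) cuv (mulrAC _ v u) (mulrAC c v u) cuv.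
  exact: cube.
rewrite !mulr_sumr.
under eq_bigr do rewrite mulrCA -/(f _).
under [RHS]eq_bigr do rewrite mulrCA -/(f _).
have : forall N, \sum_(0 <= a < N * p) (-1) ^+ a * f a =
   if odd N then \sum_(0 <= a < p) (-1) ^+ a * f a else 0.
  elim=> [|N IHN]; first by rewrite big_nil.
  rewrite mulSn (@big_cat_nat _ _ _ p) ?leq_addr //= (sum_nat_shift _ p).
  rewrite [X in _ + X](_ : _ = - \sum_(0 <= a < N * p) (-1) ^+ a * f a).
    by rewrite IHN; case: (odd N); rewrite /= ?subrr ?oppr0 ?addr0.
  rewrite -sumrN; apply: eq_bigr => a _.
  by rewrite fp exprD -[(-1) ^+ p]signr_odd p_odd mulrN1 mulNr.
by move/(_ (p ^ s)%N); rewrite -expnSr => ->; rewrite oddX p_odd orbT.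
Qed.

Lemma harmonic_triangle (m : nat) : triangle_sum harmonic_phi q m =
  - (p ^ s * m)%:R * \sum_(0 <= a < p) (-1) ^+ a * unit_inv (a%:R : Zq) ^+ 3.
Proof.
have q0 : (q%:R : Zq) = 0 by rewrite pchar_Zp.
have natq i : (i <= q)%N -> (q - i)%:R = - i%:R :> Zq.
  by move=> le_iq; rewrite natrB // q0 sub0r.
(* The conditions of [triangle_sum2] on [harmonic_phi] follow from q = 0 in [Zq]. *)
apply: (mulIr unit2Zq); rewrite !mulr_natr triangle_sum2.
- rewrite harmonic_square alternating_cube_sum natrM.
  by ring.
- by rewrite oddX p_odd orbT.
- by move=> i j; rewrite /harmonic_phi addnAC !natrD q0 !addr0.
- by move=> i j; rewrite /harmonic_phi addnA !natrD q0 !addr0.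
- by move=> j; rewrite /harmonic_phi unit_inv0 !mul0r oppr0.
- by move=> i; rewrite /harmonic_phi unit_inv0 mulr0 mul0r oppr0.
- by move=> i le_iq; rewrite /harmonic_phi subnKC // q0 unit_inv0 mulr0 oppr0.
move=> i j le_iq le_jq; rewrite /harmonic_phi natrD !natq // -opprD -natrD.
by rewrite !unit_invN mulrNN mulrN opprK.
Qed.

End PrimePowerModulus.

(** * Alternating power sums and Bernoulli numbers *)

(** Divisibility by X^M expresses equality of power series up to degree M - 1, so series identities
    become polynomial algebra. *)
Lemma dvdXn_coefP (F : fieldType) (M : nat) (P : {poly F}) :
  reflect (forall i, (i < M)%N -> P`_i = 0) ('X^M %| P).
Proof.
apply: (iffP (dvdpP _ _)) => [[Q ->] i lt_iM|P0]; first by rewrite coefMXn lt_iM.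
exists (drop_poly M P); rewrite -{1}[P](poly_take_drop M).
rewrite [take_poly M P](_ : _ = 0) ?add0r //; apply/polyP => i.
by rewrite coef_take_poly coef0; case: ifP => // /P0.
Qed.

(** The coefficients of e^x e^x = e^(2x). *)
Lemma sum_invf_fact (i : nat) :
  \sum_(k < i.+1) (k`!%:R)^-1 * ((i - k)`!%:R)^-1 = 2 ^+ i / i`!%:R :> rat.
Proof.
rewrite (_ : 2 = 1 + 1 :> rat) // exprDn mulr_suml; apply: eq_bigr => k _.
rewrite !expr1n mulr1 -(bin_fact (ltn_ord k : (k <= i)%N)) !natrM mulr_natl.
by field; rewrite !fact_neq0 pnatr_eq0 -lt0n bin_gt0 -ltnS ltn_ord.
Qed.

(** This is G_k / (2 k!) for the Genocchi numbers G_k, generated by 2x / (e^x + 1). *)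
Definition genocchi_coef (k : nat) : rat := (1 - 2 ^+ k) * bernoulli k / k`!%:R.

(* With B(x) = x / (e^x - 1), the coefficients of B(x) - B(2x) = x / (e^x + 1). *)
Lemma genocchi_coef_rec (n : nat) :
  \sum_(k < n.+1) genocchi_coef k / (n - k)`!%:R + genocchi_coef n =
  (n == 1%N)%:R.
Proof.
(* One degree beyond n, because cancelling [e], which starts at x, loses one. The truncations [e],
   [e2], [b], [b2] are those of e^x - 1, e^(2x) - 1, B(x) and B(2x). *)
pose M := n.+2.
pose e : {poly rat} := \poly_(i < M) fps_expm1 i.
pose e2 : {poly rat} := \poly_(i < M) (2 ^+ i * fps_expm1 i).
pose b : {poly rat} := \poly_(i < M) (bernoulli i / i`!%:R).
pose b2 : {poly rat} := \poly_(i < M) (2 ^+ i * (bernoulli i / i`!%:R)).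
have be i : (i < M)%N -> (b * e)`_i = fps_X i.
  move=> lt_iM; rewrite -bernoulliP coefM; apply: eq_bigr => k _.
  by rewrite !coef_poly !ifT //; move: (ltn_ord k); lia.
have be_dvd : 'X^M %| b * e - 'X.
  by apply/dvdXn_coefP => i lt_iM; rewrite coefB be // coefX subrr.
have be2_dvd : 'X^M %| b2 * e2 - 2 *: 'X.
  apply/dvdXn_coefP => i lt_iM; rewrite coefB coefZ coefX.
  rewrite (_ : (b2 * e2)`_i = 2 ^+ i * (b * e)`_i); last first.
    rewrite !coefM mulr_sumr; apply: eq_bigr => k _.
    have le_ki : (k <= i)%N by rewrite -ltnS.
    rewrite !coef_poly !ifT; [|lia|lia|lia|lia].
    have -> : 2 ^+ i = 2 ^+ k * 2 ^+ (i - k) :> rat by rewrite -exprD subnKC.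
    by ring.
  by rewrite be // /fps_X; case: eqP => [->|_]; rewrite ?expr1 ?subrr // !mulr0 subrr.
(* e^(2x) - 1 = (e^x - 1) (e^x + 1), where e^x + 1 is [e + 2]. *)
have e2_dvd : 'X^M %| e2 - e * (e + 2%:P).
  apply/dvdXn_coefP => i lt_iM.
  pose f : {poly rat} := \poly_(i < M) (i`!%:R)^-1.
  have fE : e = f - 1.
    apply/polyP => j; rewrite coefB coef1 !coef_poly /fps_expm1.
    by case: j => [|j] /=; rewrite ?fact0 ?invr1 ?subrr ?subr0.
  rewrite (_ : e * (e + 2%:P) = f * f - 1); last first.
    by rewrite fE (_ : 2%:P = 1 + 1 :> {poly rat}) ?polyCD //; ring.
  rewrite !coefB coef1 coef_poly lt_iM coefM.
  rewrite (eq_bigr (fun k : 'I_i.+1 => (k`!%:R)^-1 * ((i - k)`!%:R)^-1)).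
    rewrite sum_invf_fact /fps_expm1; case: i lt_iM => [|i] _ /=.
      by rewrite fact0 expr0 invr1 mulr0 mul1r subrr.
    by rewrite subr0 subrr.
  by move=> k _; rewrite !coef_poly !ifT //; move: (ltn_ord k); lia.
pose W := (b - b2) * (e + 2%:P) - 'X.
have eW_dvd : 'X^M %| e * W.
  rewrite (_ : e * W = (b * e - 'X) * (e + 2%:P) - (b2 * e2 - 2 *: 'X)
                       + b2 * (e2 - e * (e + 2%:P))).
    by rewrite dvdp_add ?[_ %| b2 * _]dvdp_mull // dvdp_sub // dvdp_mulr.
  by rewrite /W -mul_polyC; ring.
have W0 i : (i < n.+1)%N -> W`_i = 0.
  elim/ltn_ind: i => i IHi lt_in.
  have /dvdXn_coefP /(_ i.+1 lt_in) := eW_dvd.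
  rewrite coefM 2!big_ord_recl /= !coef_poly /= mul0r add0r subn1 /=.
  rewrite /fps_expm1 /= invr1 mul1r big1 ?addr0 // => k _.
  by rewrite IHi ?mulr0 //; rewrite /bump /=; move: (ltn_ord k); lia.
have := W0 n (ltnSn n); rewrite /W coefB coefX mulrDr coefD coefMC.
rewrite coefM => /eqP; rewrite subr_eq0 => /eqP <-.
have cE k : (k < M)%N -> (b - b2)`_k = genocchi_coef k.
  by move=> lt_kM; rewrite coefB !coef_poly lt_kM /genocchi_coef; ring.
rewrite big_ord_recr [in RHS]big_ord_recr /= subnn coef_poly /= mulr0 addr0.
rewrite cE // fact0 divr1 -addrA -mulr2n mulr_natr; congr (_ + _).
apply: eq_bigr => k _; rewrite cE ?coef_poly; last by move: (ltn_ord k); lia.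
rewrite ifT; last by move: (ltn_ord k); lia.
by rewrite /fps_expm1 ifF //; move: (ltn_ord k); lia.
Qed.

(* m! times the coefficient of x^m in 2 / (e^x + 1). *)
Definition euler_value (m : nat) : rat :=
  2 * (1 - 2 ^+ m.+1) * bernoulli m.+1 / m.+1%:R.

Lemma binomial_rec_fact (u : nat -> rat) (m : nat) :
  \sum_(k < m.+1) 'C(m, k)%:R * u k =
  m`!%:R * \sum_(k < m.+1) (u k / k`!%:R) / (m - k)`!%:R.
Proof.
rewrite mulr_sumr; apply: eq_bigr => k _.
rewrite -(bin_fact (ltn_ord k : (k <= m)%N)) !natrM.
by field; rewrite !fact_neq0.
Qed.

(** The Genocchi recurrence at m + 1, shifted down by one, which is possible because the coefficient
    of index 0 vanishes. *)
Lemma euler_value_rec (m : nat) :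
  \sum_(k < m.+1) 'C(m, k)%:R * euler_value k + euler_value m =
  2 * (m == 0%N)%:R.
Proof.
have E k : euler_value k / k`!%:R = 2 * genocchi_coef k.+1.
  rewrite /euler_value /genocchi_coef factS natrM.
  by field; rewrite fact_neq0 nat1r pnatr_eq0.
have := genocchi_coef_rec m.+1.
rewrite big_ord_recl {1}/genocchi_coef expr0 subrr !mul0r add0r eqSS => H.
rewrite binomial_rec_fact (eq_bigr (fun k : 'I_m.+1 =>
  2 * (genocchi_coef k.+1 / (m - k)`!%:R))) => [|k _]; last by rewrite E mulrA.
have -> : euler_value m = m`!%:R * (2 * genocchi_coef m.+1).
  by rewrite -E mulrC divfK ?fact_neq0.
rewrite -mulr_sumr -mulrDr -mulrDr [X in 2 * X]H.
by case: m {E H} => [|m] //=; rewrite !mulr0.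
Qed.

Definition alternating_power_sum (p m : nat) : rat :=
  \sum_(0 <= a < p) (-1) ^+ a * a%:R ^+ m.

(** By the binomial theorem the first sum is that of (-1)^a (a + 1)^m, which is minus the original
    sum shifted by one. Only the end terms 0^m and - (-1)^p p^m survive. *)
Lemma alternating_power_sum_rec (p m : nat) : odd p ->
  \sum_(k < m.+1) 'C(m, k)%:R * alternating_power_sum p k
    + alternating_power_sum p m = (m == 0%N)%:R + p%:R ^+ m.
Proof.
move=> p_odd.
have -> : \sum_(k < m.+1) 'C(m, k)%:R * alternating_power_sum p k =
    \sum_(0 <= a < p) (-1) ^+ a * a.+1%:R ^+ m.
  under eq_bigr do rewrite mulr_sumr.
  rewrite exchange_big /=; apply: eq_bigr => a _.
  rewrite -natr1 addrC exprDn mulr_sumr; apply: eq_bigr => k _.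
  by rewrite expr1n mul1r mulrCA mulr_natl.
pose f a : rat := (-1) ^+ a * a%:R ^+ m.
have -> : \sum_(0 <= a < p) (-1) ^+ a * a.+1%:R ^+ m =
    - \sum_(0 <= a < p) f a.+1.
  by rewrite -sumrN; apply: eq_bigr => a _; rewrite /f exprS mulN1r mulNr opprK.
have H : alternating_power_sum p m + f p = f 0%N + \sum_(0 <= a < p) f a.+1.
  by rewrite -big_nat_recl // big_nat_recr.
have -> : \sum_(0 <= a < p) f a.+1 = alternating_power_sum p m + f p - f 0%N.
  by rewrite H addrC addKr.
rewrite /f expr0 mul1r -signr_odd p_odd expr1 expr0n; ring.
Qed.

(** * Reduction of p-integral rationals *)

Lemma p_integral_frac (p : nat) (a : int) (b : nat) :
  (0 < b)%N -> coprime b p -> p_integral p (a%:~R / b%:R).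
Proof.
move=> b_gt0 cop_bp; set x : rat := _ / _.
have b_neq0 : b%:R != 0 :> rat by rewrite pnatr_eq0 -lt0n.
have E : (numq x * b%:Z = a * denq x)%R.
  apply: (@intr_inj rat); rewrite !rmorphM /= -[b%:Z%:~R]/(b%:R).
  by rewrite numqE mulrAC {1}/x divfK.
have dvd_b : (`|denq x| %| b)%N.
  have : (`|denq x| %| `|numq x| * b)%N.
    by rewrite -[b]absz_nat -abszM E abszM dvdn_mull.
  by rewrite Gauss_dvdr // coprime_sym coprime_num_den.
exact: coprime_dvdl cop_bp.
Qed.

Section Reduction.

Variables (p s : nat).
Hypothesis p_prime : prime p.
Local Notation q := (p ^ s.+1)%N.
Local Notation Zq := 'Z_q.

(** The graph of the ring map from the p-integral rationals to Z/q; as a relation it needs no chosen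
    fraction. That x is determined modulo q by z is [reduces_eq_modp]. *)
Definition reduces_to (x : rat) (z : Zq) : Prop :=
  exists a : int, exists b : nat,
    [/\ coprime b p, x = a%:~R / b%:R & z = a%:~R / b%:R].

Lemma coprime_p_gt0 (b : nat) : coprime b p -> (0 < b)%N.
Proof. by case: b => //; rewrite /coprime gcd0n => /eqP p1; move: p_prime; rewrite p1. Qed.

Lemma coprime_p_neq0 (b : nat) : coprime b p -> b%:R != 0 :> rat.
Proof. by move=> /coprime_p_gt0; rewrite pnatr_eq0 -lt0n. Qed.

Lemma coprime_p_unit (b : nat) : coprime b p -> (b%:R : Zq) \is a GRing.unit.
Proof. by rewrite coprime_sym prime_coprime // unit_natZq. Qed.

Lemma reduces_int (a : int) : reduces_to a%:~R a%:~R.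
Proof. by exists a, 1%N; rewrite coprime1n !divr1. Qed.

Lemma reduces_inv (k : nat) : coprime k p -> reduces_to k%:R^-1 k%:R^-1.
Proof. by move=> cop_kp; exists 1, k; rewrite !mul1r. Qed.

Lemma reducesD x y z t :
  reduces_to x z -> reduces_to y t -> reduces_to (x + y) (z + t).
Proof.
move=> [a [b [cb -> ->]]] [c [d [cd -> ->]]].
exists (a * d%:Z + c * b%:Z), (b * d)%N; split; first by rewrite coprimeMl cb.
  rewrite rmorphD !rmorphM ?natrM /= -!pmulrn.
  by field; rewrite !coprime_p_neq0.
have [bU dU] := (coprime_p_unit cb, coprime_p_unit cd).
have bdU : (b%:R * d%:R : Zq) \is a GRing.unit by rewrite unitrMl.
rewrite rmorphD !rmorphM ?natrM /= -!pmulrn; apply: (mulIr bdU).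
by rewrite divrK // mulrDl mulrA divrK // (mulrC b%:R) mulrA divrK.
Qed.

Lemma reducesM x y z t :
  reduces_to x z -> reduces_to y t -> reduces_to (x * y) (z * t).
Proof.
move=> [a [b [cb -> ->]]] [c [d [cd -> ->]]].
exists (a * c), (b * d)%N; split; first by rewrite coprimeMl cb.
  by rewrite rmorphM ?natrM /=; field; rewrite !coprime_p_neq0.
rewrite rmorphM ?natrM /= invrM ?coprime_p_unit //.
by rewrite mulrACA [b%:R^-1 * _]mulrC.
Qed.

Lemma reducesX x z (k : nat) : reduces_to x z -> reduces_to (x ^+ k) (z ^+ k).
Proof.
move=> xz; elim: k => [|k IHk]; first exact: (reduces_int 1).
by rewrite !exprS; exact: reducesM.
Qed.

Lemma reduces_sum (I : Type) (l : seq I) (P : pred I) (f : I -> rat) (g : I -> Zq) :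
  (forall i, P i -> reduces_to (f i) (g i)) ->
  reduces_to (\sum_(i <- l | P i) f i) (\sum_(i <- l | P i) g i).
Proof.
move=> fg; apply: (big_rec2 reduces_to) => [|i z x Pi]; first exact: (reduces_int 0).
by apply: reducesD; exact: fg.
Qed.

Lemma reduces_integral x z : reduces_to x z -> p_integral p x.
Proof.
move=> [a [b [cb -> _]]]; apply: p_integral_frac => //; exact: coprime_p_gt0 cb.
Qed.

Lemma integral_reduces x : p_integral p x -> exists z, reduces_to x z.
Proof.
move=> ix; exists ((numq x)%:~R / `|denq x|%:R), (numq x), `|denq x|%N.
split=> //; rewrite -[X in X = _]divq_num_den; congr (_ / _).
by rewrite pmulrn gez0_abs // ltW.
Qed.

(** Equal residues mean that q divides a d - c b, so (x - y) / q has denominator b d. *)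
Lemma reduces_eq_modp x y z :
  reduces_to x z -> reduces_to y z -> eq_modp p s.+1 x y.
Proof.
move=> [a [b [cb -> ->]]] [c [d [cd -> E]]].
have [bU dU] := (coprime_p_unit cb, coprime_p_unit cd).
have q_gt1 := ppow_gt1 s p_prime.
have dvd_q : (q%:Z %| a * d%:Z - c * b%:Z)%Z.
  have : ((a * d%:Z - c * b%:Z)%:~R : Zq) = 0.
    rewrite rmorphB !rmorphM /= -!pmulrn; apply/eqP; rewrite subr_eq0; apply/eqP.
    by rewrite -[a%:~R](divrK bU) E mulrAC divrK // mulrC.
  case: (a * d%:Z - c * b%:Z) => k; rewrite ?NegzE.
    by rewrite -pmulrn => /eqP; rewrite natZp_eq0.
  by rewrite rmorphN /= -pmulrn => /eqP; rewrite oppr_eq0 natZp_eq0 // dvdzN.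
have /dvdzP[k kE] := dvd_q; rewrite /eq_modp.
have -> : (a%:~R / b%:R - c%:~R / d%:R) / p%:R ^+ s.+1 =
    k%:~R / (b * d)%:R :> rat.
  have : ((a * d%:Z - c * b%:Z)%:~R : rat) = (k * q%:Z)%:~R by rewrite kE.
  rewrite rmorphB !rmorphM /= -!pmulrn ?natrX ?natrM => H.
  rewrite -[k%:~R](@mulfK _ (p%:R ^+ s.+1)); last first.
    by rewrite expf_neq0 // pnatr_eq0 -lt0n prime_gt0.
  rewrite -H; field.
  by rewrite !coprime_p_neq0 // expf_neq0 // pnatr_eq0 -lt0n prime_gt0.
by rewrite p_integral_frac ?coprimeMl ?cb // muln_gt0 !coprime_p_gt0.
Qed.

End Reduction.

(** * Closure properties of the p-integral rationals, by reduction modulo p *)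

Section PIntegral.

Variable p : nat.
Hypothesis p_prime : prime p.
Local Notation integral := (p_integral p).

Lemma p_integralD x y : integral x -> integral y -> integral (x + y).
Proof.
move=> /(integral_reduces 0)[z xz] /(integral_reduces 0)[t yt].
exact (reduces_integral p_prime (reducesD p_prime xz yt)).
Qed.

Lemma p_integralM x y : integral x -> integral y -> integral (x * y).
Proof.
move=> /(integral_reduces 0)[z xz] /(integral_reduces 0)[t yt].
exact (reduces_integral p_prime (reducesM p_prime xz yt)).
Qed.

Lemma p_integral_int (a : int) : integral a%:~R.
Proof. exact (reduces_integral p_prime (reduces_int p 0 a)). Qed.

Lemma p_integral_nat (k : nat) : integral k%:R.
Proof. by rewrite pmulrn p_integral_int. Qed.

Lemma p_integral_inv (k : nat) : coprime k p -> integral k%:R^-1.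
Proof. by move=> kp; exact (reduces_integral p_prime (reduces_inv 0 kp)). Qed.

Lemma p_integralN x : integral x -> integral (- x).
Proof. by move=> ix; rewrite -mulN1r p_integralM // (p_integral_int (-1)). Qed.

Lemma p_integralB x y : integral x -> integral y -> integral (x - y).
Proof. by move=> ix iy; rewrite p_integralD // p_integralN. Qed.

Lemma p_integralX x (k : nat) : integral x -> integral (x ^+ k).
Proof.
move=> ix; elim: k => [|k IHk]; first exact: (p_integral_nat 1).
by rewrite exprS p_integralM.
Qed.

Lemma p_integral_sum (I : Type) (l : seq I) (P : pred I) (f : I -> rat) :
  (forall i, P i -> integral (f i)) -> integral (\sum_(i <- l | P i) f i).
Proof.
move=> If; apply: (big_ind (fun x => integral x)) => //; first exact: (p_integral_nat 0).
exact: p_integralD.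
Qed.

End PIntegral.

(** * The alternating sum of inverse cubes modulo p *)

Section AlternatingCubes.

Variable p : nat.
Hypothesis p_prime : prime p.
Hypothesis p_odd : odd p.

Lemma prime_neq0_rat : p%:R != 0 :> rat.
Proof. by rewrite pnatr_eq0 -lt0n prime_gt0. Qed.

(* Both sequences satisfy the same recurrence modulo p, in which the leading
   coefficient 2 is invertible. *)
Lemma alternating_power_sum_euler (m : nat) :
  p_integral p ((alternating_power_sum p m - euler_value m) / p%:R).
Proof.
pose D k := alternating_power_sum p k - euler_value k.
elim/ltn_ind: m => m IHm.
have DE : D m *+ 2 = p%:R ^+ m - (m == 0%N)%:R - \sum_(k < m) 'C(m, k)%:R * D k.
  have := alternating_power_sum_rec m p_odd; have := euler_value_rec m.
  rewrite !big_ord_recr /= binn !mul1r => H1 H2.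
  under eq_bigr do rewrite mulrBr.
  rewrite sumrB /D mulr2n.
  by move: H1 H2; set s1 := \sum_(_ < _) _; set s2 := \sum_(_ < _) _; lra.
have -> : D m / p%:R = 2%:R^-1 * ((p%:R ^+ m - (m == 0%N)%:R) / p%:R
    - \sum_(k < m) 'C(m, k)%:R * (D k / p%:R)).
  under eq_bigr do rewrite mulrA.
  by rewrite -mulr_suml -mulrBl -DE -mulr_natr; field; rewrite prime_neq0_rat.
apply: p_integralM => //; first by rewrite p_integral_inv // coprime2n.
apply: p_integralB => //.
  (* The numerator is 0 for m = 0 and p^m otherwise. *)
  case: m {IHm DE} => [|m]; first by rewrite subrr mul0r (p_integral_nat p_prime 0).
  by rewrite subr0 exprSr mulfK ?prime_neq0_rat // p_integralX // p_integral_nat.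
by apply: p_integral_sum => // k _; rewrite p_integralM ?p_integral_nat // IHm.
Qed.

(** The index a = 0 contributes 0, since 0^-1 = 0 in [rat]. *)
Definition alternating_cubes : rat :=
  \sum_(0 <= a < p) (-1) ^+ a * a%:R^-1 ^+ 3.

Lemma fermat_quotient (a : nat) : (0 < a < p)%N ->
  exists k : nat, (a ^ p.-1 = k * p + 1)%N.
Proof.
move=> /andP[a_gt0 lt_ap].
have : coprime a p by rewrite coprime_sym prime_coprime // gtnNdvd.
move/Euler_exp_totient; rewrite totient_prime // => E.
exists (a ^ p.-1 %/ p)%N; rewrite {1}(divn_eq (a ^ p.-1) p) E.
by rewrite modn_small ?prime_gt1.
Qed.

(** Fermat gives a^(p-4) = (k p + 1) / a^3. The bound on p keeps p - 4 positive, so that a = 0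
    contributes 0 to both sums. *)
Lemma alternating_cubes_power : (4 < p)%N ->
  p_integral p ((alternating_cubes - alternating_power_sum p (p - 4)) / p%:R).
Proof.
move=> p_gt4; rewrite /alternating_cubes /alternating_power_sum -sumrB mulr_suml.
rewrite big_nat; apply: p_integral_sum => // a /andP[_ lt_ap].
have [->|a_gt0] := posnP a.
  rewrite invr0 !expr0n subn_eq0 leqNgt p_gt4 /= subrr mul0r.
  exact: (p_integral_nat p_prime 0).
have [|k kE] := fermat_quotient (a := a); first by rewrite a_gt0.
have a_neq0 : a%:R != 0 :> rat by rewrite pnatr_eq0 -lt0n.
have E : a%:R ^+ (p - 4) * a%:R ^+ 3 = k%:R * p%:R + 1 :> rat.
  rewrite -exprD (_ : p - 4 + 3 = p.-1)%N; last by lia.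
  by rewrite -natrX kE natrD natrM.
rewrite (_ : _ / _ = (-1) ^+ a * - k%:R * a%:R^-1 ^+ 3).
  apply: p_integralM => //; first apply: p_integralM => //.
  - by rewrite p_integralX // (p_integral_int p_prime (-1)).
  - by rewrite p_integralN // p_integral_nat.
  by rewrite p_integralX // p_integral_inv // coprime_sym prime_coprime // gtnNdvd.
rewrite -mulrBr -!mulrA; congr (_ * _).
have -> : a%:R ^+ (p - 4) = (k%:R * p%:R + 1) * a%:R^-1 ^+ 3 :> rat.
  by rewrite -E exprVn mulfK // expf_neq0.
by field; rewrite a_neq0 prime_neq0_rat.
Qed.

(** Modulo p, 2^(p-3) is 1/4 and p - 3 is -3, so [euler_value (p - 4)] becomes 2 (3/4) B / (-3) = -
    B / 2. The case p = 3 is computed directly. *)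
Lemma alternating_cubes_bernoulli :
  p_integral p ((alternating_cubes + bernoulli (p - 3) / 2) / p%:R).
Proof.
have [p_le4|p_gt4] := leqP p 4.
  have p3 : p = 3%N.
    by have := prime_gt1 p_prime; move: p_odd p_le4; case: p => [|[|[|[|[|]]]]].
  have B0 : bernoulli 0 = 1.
    by have := bernoulli_divf 0; rewrite big_ord0 fact0 divr1 subr0.
  rewrite /alternating_cubes p3 subnn B0.
  rewrite (_ : _ / 3%:R = (-1)%:~R / 8%:R) ?p_integral_frac //.
  by rewrite big_ltn // invr0 expr0n mulr0 add0r 2?big_ltn // big_geq //; field.
pose B := bernoulli (p - 3); pose E := euler_value (p - 4).
pose G := alternating_power_sum p (p - 4).
have GE := alternating_power_sum_euler (p - 4).
have SG := alternating_cubes_power p_gt4.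
have iG : p_integral p G.
  apply: p_integral_sum => // a _; rewrite p_integralM // p_integralX //.
    by rewrite (p_integral_int p_prime (-1)).
  exact: p_integral_nat.
have iE : p_integral p E.
  rewrite (_ : E = G - (G - E) / p%:R * p%:R).
    by rewrite p_integralB // p_integralM // p_integral_nat.
  by rewrite divfK ?prime_neq0_rat // subKr.
have [|k kE] := fermat_quotient (a := 2); first by lia.
(* From 2^(p-1) = k p + 1 one gets 4 (1 - 2^(p-3)) = - d, and d is prime to p because p > 3. Thus B
   / 2 = E (3 - p) / d, where E is integral because G is. *)
pose d := (k * p - 3)%N.
have kp_ge : (15 <= k * p)%N.
  have : (2 ^ 4 <= 2 ^ p.-1)%N by rewrite leq_exp2l //; lia.
  by rewrite kE; lia.
have cop_d : coprime d p.
  rewrite coprime_sym prime_coprime //; apply/negP => p_dvd_d.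
  have : (p %| 3)%N.
    rewrite (_ : 3 = k * p - d)%N; last by rewrite /d; lia.
    by rewrite dvdn_sub // dvdn_mull.
  by move=> /dvdn_leq -/(_ isT); lia.
have d_neq0 : d%:R != 0 :> rat by rewrite pnatr_eq0; rewrite /d; lia.
have dE : d%:R = k%:R * p%:R - 3 :> rat by rewrite /d natrB ?natrM //; lia.
have EB : E * (3 - p%:R) = B / 2 * d%:R.
  have e3 : (p - 4).+1 = (p - 3)%N by lia.
  have w4 : 2 ^+ (p - 3) * 4 = k%:R * p%:R + 1 :> rat.
    have := congr1 (fun n => n%:R : rat) kE; rewrite natrX natrD natrM => <-.
    by rewrite (_ : p.-1 = p - 3 + 2)%N ?exprD //; lia.
  have p3_neq0 : p%:R - 3 != 0 :> rat.
    by rewrite -natrB ?pnatr_eq0; lia.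
  rewrite /E /euler_value e3 natrB; last by lia.
  rewrite -[3 - p%:R]opprB mulrN divfK // dE -/B.
  have -> : 2 ^+ (p - 3) = (k%:R * p%:R + 1) / 4 :> rat by rewrite -w4 mulfK.
  by field.
(* The last term is (E + B / 2) / p, as d + 3 - p = p (k - 1). *)
rewrite (_ : _ / p%:R = (alternating_cubes - G) / p%:R + (G - E) / p%:R
    + E * (k%:R - 1) * d%:R^-1).
  rewrite p_integralD ?p_integralD // p_integralM ?p_integral_inv // p_integralM //.
  by rewrite p_integralB // ?p_integral_nat // (p_integral_nat p_prime 1).
have -> : bernoulli (p - 3) / 2 = E * (3 - p%:R) / d%:R by rewrite EB mulfK.
rewrite [in E * (k%:R - 1)](_ : k%:R - 1 = (d%:R + 3 - p%:R) / p%:R).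
  by field; rewrite d_neq0 prime_neq0_rat.
by rewrite dE; field; rewrite prime_neq0_rat.
Qed.

End AlternatingCubes.

(** * From the triple sum to the triangle sum, and the conclusion *)

Section TripleSum.

Variables (p s : nat).
Hypothesis p_prime : prime p.

Definition prime_to_inv (k : nat) : rat := if prime_to p k then k%:R^-1 else 0.

Lemma reduces_prime_to_inv (k : nat) :
  @reduces_to p s (prime_to_inv k) (unit_inv k%:R).
Proof.
rewrite /prime_to_inv /unit_inv unit_natZq // -prime_coprime // coprime_sym.
rewrite /prime_to; case: (boolP (coprime k p)) => [cop_kp|_]; last first.
  by rewrite andbF; exact: (reduces_int p s 0).
by rewrite (coprime_p_gt0 p_prime cop_kp); exact: reduces_inv.
Qed.

Lemma reduces_prime_inv (k : nat) : (k < p)%N ->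
  @reduces_to p s (k%:R^-1) (unit_inv k%:R).
Proof.
move=> lt_kp; rewrite -[_^-1](_ : prime_to_inv k = _).
  exact: reduces_prime_to_inv.
rewrite /prime_to_inv /prime_to; case: posnP => [->|k_gt0]; first by rewrite invr0.
by rewrite /= coprime_sym prime_coprime // gtnNdvd.
Qed.

Lemma reduces_sign (i : nat) : @reduces_to p s ((-1) ^+ i) ((-1) ^+ i).
Proof. exact: (reducesX p_prime i (reduces_int p s (-1))). Qed.

(** Only k = n - (i + j) can occur, and its positivity is the strict bound i + j < n. *)
Lemma sum_third_index (n i j : nat) :
  \sum_(k < n.+1 |
      [&& (i + j + k == n)%N, prime_to p i, prime_to p j & prime_to p k])
    (-1) ^+ i / (i * j * k)%:R =
  if (i + j < n)%N then
    (-1) ^+ i * (prime_to_inv i * prime_to_inv j * prime_to_inv (n - (i + j)))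
  else 0.
Proof.
case: ifP => [lt_ijn|ge_ijn]; last first.
  rewrite big_pred0 // => k; apply/negbTE/negP => /and4P[/eqP Ek _ _ /andP[k_gt0 _]].
  by move: ge_ijn; lia.
have lt_k0 : (n - (i + j) < n.+1)%N by lia.
rewrite big_mkcond (bigD1 (Ordinal lt_k0)) //= big1 ?addr0 => [|k k_neq].
  rewrite /prime_to_inv subnKC ?eqxx /=; last by lia.
  case: (prime_to p i); last by rewrite !mul0r mulr0.
  case: (prime_to p j); last by rewrite mulr0 mul0r mulr0.
  by case: (prime_to p _); rewrite ?mulr0 //= !natrM !invfM.
case: ifP => // /and4P[/eqP Ek _ _ _]; case/negP: k_neq.
by apply/eqP/val_inj => /=; lia.
Qed.

Lemma triple_sum_reduces (m n : nat) : n = (m * p ^ s.+1)%N ->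
  @reduces_to p s
    (\sum_(i < n.+1) \sum_(j < n.+1) \sum_(k < n.+1 |
         [&& (i + j + k == n)%N, prime_to p i, prime_to p j & prime_to p k])
       (-1) ^+ i / (i * j * k)%:R)
    (triangle_sum (harmonic_phi p s) (p ^ s.+1) m).
Proof.
move=> nE.
have n0 : (n%:R : 'Z_(p ^ s.+1)) = 0.
  by rewrite nE natrM pchar_Zp ?mulr0 // ppow_gt1.
have -> : triangle_sum (harmonic_phi p s) (p ^ s.+1) m =
    \sum_(i < n.+1) \sum_(j < n.+1) if (i + j < n)%N
      then (-1) ^+ i * harmonic_phi p s i j else 0.
  (* The extra row i = n is empty. *)
  rewrite /triangle_sum -nE big_ord_recr /= [X in _ + X]big1 => [|j _].
    rewrite addr0 big_mkord; apply: eq_bigr => i _.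
    rewrite (big_nat_widen _ _ n.+1) ?big_mkord; last by lia.
    rewrite mulr_sumr big_mkcond; apply: eq_bigr => j _ /=.
    by rewrite (_ : (j < n - i)%N = (i + j < n)%N) //; lia.
  by rewrite ifF //; lia.
apply: reduces_sum => // i _; apply: reduces_sum => // j _.
rewrite sum_third_index; case: ifP => [lt_ijn|_]; last exact: (reduces_int p s 0).
apply: reducesM => //; first exact: reduces_sign.
(* Since n = 0 modulo q, the third inverse is minus that of i + j. *)
rewrite [harmonic_phi _ _ _ _](_ : _ =
  unit_inv i%:R * unit_inv j%:R * unit_inv (n - (i + j))%:R).
  by do 2?[apply: reducesM => //]; exact: reduces_prime_to_inv.
by rewrite natrB 1?ltnW // n0 sub0r unit_invN mulrN.
Qed.

End TripleSum.

Unset Implicit Arguments.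

Theorem theorem2 (n p r : nat) (n_gt0 : (0 < n)%N) (p_prime : prime p)
    (p_ge3 : (3 <= p)%N) (r_ge1 : (1 <= r)%N) (pr_dvd_n : (p ^ r %| n)%N) :
  eq_modp p r
    (\sum_(i < n.+1) \sum_(j < n.+1) \sum_(k < n.+1 |
         [&& (i + j + k == n)%N, prime_to p i, prime_to p j & prime_to p k])
       (-1) ^+ i / (i * j * k)%:R)
    (n%:R / (2 * p)%:R * bernoulli (p - 3)).
Proof.
have p_odd : odd p by case: (even_prime p_prime) p_ge3 => [->|].
case: r r_ge1 pr_dvd_n => // s _ /dvdnP[m nE].
have := triple_sum_reduces p_prime nE; set S := (X in eq_modp _ _ X _).
rewrite harmonic_triangle // => Sred.
have cred : @reduces_to p s (- (p ^ s * m)%:R * alternating_cubes p)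
    (- (p ^ s * m)%:R * \sum_(0 <= a < p) (-1) ^+ a
       * unit_inv (a%:R : 'Z_(p ^ s.+1)) ^+ 3).
  apply: reducesM => //.
    by have := reduces_int p s (- (p ^ s * m)%:Z); rewrite !rmorphN /= -!pmulrn.
  rewrite /alternating_cubes !big_nat; apply: reduces_sum => // a /andP[_ lt_ap].
  apply: reducesM => //; first exact: reduces_sign.
  by apply: reducesX => //; exact: reduces_prime_inv.
have := reduces_eq_modp p_prime Sred cred; rewrite /eq_modp => iS.
have p_neq0 := prime_neq0_rat p_prime.
(* With C = [alternating_cubes p] and n / (2 p) = p^s m / 2, insert - p^s m C: the factor p^s lifts
   the congruence for C modulo p to one modulo p^(s+1). *)
rewrite [X in p_integral p X](_ : _ = (S - - (p ^ s * m)%:R * alternating_cubes p) / p%:R ^+ s.+1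
  - m%:R * ((alternating_cubes p + bernoulli (p - 3) / 2) / p%:R)).
  rewrite p_integralB // p_integralM // ?p_integral_nat //.
  exact: alternating_cubes_bernoulli.
rewrite nE !natrM !natrX exprS; field.
by rewrite p_neq0 expf_neq0.
Qed.
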